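(* Let $A$ be a $\mathbb C$-affine domain. The sum of any collection of prime ideals in $\mathcal B(A)$ is either prime or the unit ideal. If $\mathfrak g_i$ are $\mathfrak p_i$-primary ideals of $\mathcal B(A)$ (with $\mathfrak p_i$ prime ideals of $\mathcal B(A)$), for $i$ in some index set $I$, and if $\mathfrak p:=\sum_{i\in I}\mathfrak p_i$ is not the unit ideal, then $\sum_{i\in I}\mathfrak g_i$ is $\mathfrak p$-primary.
   Context: A $\mathbb C$-affine algebra is a finitely generated $\mathbb C$-algebra or a localization of such an algebra at a prime ideal. Fix a non-principal ultrafilter on the set of prime numbers; ''almost all $p$'' and ultraproducts $\operatorname{ulim}_p$ are with respect to it. Fix a field isomorphism $\mathbb C\cong\operatorname{ulim}_p\mathbb F_p^{\rm alg}$ ($\mathbb F_p^{\rm alg}$ the algebraic closure of $\mathbb F_p$). An approximation of $c\in\mathbb C$ is a sequence $c_p\in\mathbb F_p^{\rm alg}$ with $\operatorname{ulim}_p c_p=c$; an approximation of a polynomial $f\in\mathbb C[X]$ ($X$ a finite tuple of variables) is the sequence $f_p\in\mathbb F_p^{\rm alg}[X]$ obtained by approximating each coefficient; an approximation of an ideal is the sequence of ideals generated by approximations of a finite generating set. An approximation of $A=\mathbb C[X]/J$ (respectively of its localization at a prime ideal $\mathfrak q$) is the sequence $A_p=\mathbb F_p^{\rm alg}[X]/J_p$ (respectively its localization at $\mathfrak q_p$, which is prime for almost all $p$). It is unique up to isomorphism for almost all $p$; if $A$ is a domain, so are almost all $A_p$. The non-standard hull of $A$ is $A_\infty=\operatorname{ulim}_pA_p$,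 with natural map $A\to A_\infty$ sending an element to the ultraproduct of an approximation of it. For a domain $D$, $D^+$ is the integral closure of $D$ in an algebraic closure of its fraction field (and $D^+=0$ if $D$ is not a domain). For a $\mathbb C$-affine domain $A$, $\mathcal B(A):=\operatorname{ulim}_pA_p^+$, an $A$-algebra via $A\to A_\infty\to\mathcal B(A)$; it is unique up to $A$-algebra isomorphism. *)

(* Defs.v *)
From HB Require Import structures.
From mathcomp Require Import ssreflect ssrfun ssrbool eqtype ssrnat seq choice.
From mathcomp Require Import fintype bigop prime generic_quotient ssralg poly.
From mathcomp Require Import mxpoly fraction zmodp countalg closed_field.
From mathcomp Require Import boolp classical_sets filter reals.
From mathcomp Require Import complex.
(* A full Import of mpoly would clash with MathComp-Analysis and shadow
   symmetric; its canonical structures are all that is needed. *)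
From mathcomp Require mpoly.
Import (canonicals) mpoly.

Set Implicit Arguments.
Unset Strict Implicit.
Unset Printing Implicit Defensive.

Import GRing.Theory.

Local Open Scope classical_set_scope.
Local Open Scope ring_scope.
Local Open Scope quotient_scope.

Notation polyring k n := (mpoly.mpoly n k).

Section Ideals.
Variable R : comPzRingType.

Definition is_ideal (J : set R) : Prop :=
  [/\ J 0, forall x y, J x -> J y -> J (x + y) & forall a x, J x -> J (a * x)].

Definition is_prime_ideal (P : set R) : Prop :=
  [/\ is_ideal P, ~ P 1 & forall x y, P (x * y) -> P x \/ P y].

Definition radical (J : set R) : set R := [set x | exists n : nat, J (x ^+ n)].

Definition is_primary_ideal (G : set R) : Prop :=
  [/\ is_ideal G, ~ G 1 &
      forall x y, G (x * y) -> G x \/ exists n : nat, G (y ^+ n)].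

Definition is_primary_to (P G : set R) : Prop :=
  is_primary_ideal G /\ radical G = P.

Definition ideal_sum (I : Type) (J : I -> set R) : set R :=
  [set x | exists (n : nat) (k : 'I_n -> I) (y : 'I_n -> R),
     (forall j, J (k j) (y j)) /\ x = \sum_(j < n) y j].

Definition ideal_gen (m : nat) (f : 'I_m -> R) : set R :=
  [set x | exists a : 'I_m -> R, x = \sum_(i < m) a i * f i].

End Ideals.

Section Ultraproduct.
Context (I : Type) (U : set_system I) {FU : UltraFilter U}.
Variable R : I -> comPzRingType.

Let prodR : choiceType := {classic forall i, R i}.

Definition ueq (x y : prodR) : bool := `[< U [set i | x i = y i] >].

Lemma ueqP (x y : prodR) : reflect (U [set i | x i = y i]) (ueq x y).
Proof. exact: asboolP. Qed.

Lemma ueq_refl : reflexive ueq.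
Proof. by move=> x; apply/ueqP; apply: filterS filterT => i _. Qed.

Lemma ueq_sym : symmetric ueq.
Proof.
by move=> x y; apply/ueqP/ueqP; apply: filterS => i /=; move=> ->.
Qed.

Lemma ueq_trans : transitive ueq.
Proof.
move=> y x z /ueqP xy /ueqP yz; apply/ueqP.
by apply: filterS2 xy yz => i /= -> ->.
Qed.

Definition ueq_equiv := EquivRel ueq ueq_refl ueq_sym ueq_trans.

Definition ultraproduct : Type := {eq_quot ueq_equiv}.
HB.instance Definition _ := Choice.on ultraproduct.
HB.instance Definition _ := EqQuotient.on ultraproduct.

Definition ulim (x : forall i, R i) : ultraproduct := \pi_ultraproduct (x : prodR).

Lemma ulimP (x y : forall i, R i) : ulim x = ulim y <-> U [set i | x i = y i].
Proof. by split=> [/eqmodP /ueqP //|xy]; apply/eqmodP/ueqP. Qed.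

Lemma ulim_surj (x : ultraproduct) : exists y, ulim y = x.
Proof. by exists (repr x); rewrite /ulim reprK. Qed.

Let rep (x : ultraproduct) : forall i, R i := repr x.

Lemma ulim_rep x : ulim (rep x) = x.
Proof. by rewrite /ulim /rep reprK. Qed.

Lemma rep_ulim (x : forall i, R i) : U [set i | rep (ulim x) i = x i].
Proof. by apply/ulimP; rewrite ulim_rep. Qed.

Definition uadd (x y : ultraproduct) := ulim (fun i => rep x i + rep y i).
Definition uopp (x : ultraproduct) := ulim (fun i => - rep x i).
Definition umul (x y : ultraproduct) := ulim (fun i => rep x i * rep y i).

Lemma uaddE x y : uadd (ulim x) (ulim y) = ulim (fun i => x i + y i).
Proof.
by apply/ulimP; apply: filterS2 (rep_ulim x) (rep_ulim y) => i /= -> ->.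
Qed.

Lemma uoppE x : uopp (ulim x) = ulim (fun i => - x i).
Proof. by apply/ulimP; apply: filterS (rep_ulim x) => i /= ->. Qed.

Lemma umulE x y : umul (ulim x) (ulim y) = ulim (fun i => x i * y i).
Proof.
by apply/ulimP; apply: filterS2 (rep_ulim x) (rep_ulim y) => i /= -> ->.
Qed.

Lemma eq_ulim (x y : forall i, R i) : (forall i, x i = y i) -> ulim x = ulim y.
Proof. by move=> xy; apply/ulimP; apply: filterS filterT => i _ /=. Qed.

Lemma uaddA : associative uadd.
Proof.
move=> x y z; rewrite -(ulim_rep x) -(ulim_rep y) -(ulim_rep z) !uaddE.
by apply: eq_ulim => i; rewrite addrA.
Qed.

Lemma uaddC : commutative uadd.
Proof. by move=> x y; apply: eq_ulim => i; rewrite addrC. Qed.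

Lemma uadd0 : left_id (ulim (fun=> 0)) uadd.
Proof.
by move=> x; rewrite -(ulim_rep x) uaddE; apply: eq_ulim => i; rewrite add0r.
Qed.

Lemma uaddN : left_inverse (ulim (fun=> 0)) uopp uadd.
Proof.
move=> x; rewrite -(ulim_rep x) uoppE uaddE.
by apply: eq_ulim => i; rewrite addNr.
Qed.

HB.instance Definition _ :=
  GRing.isZmodule.Build ultraproduct uaddA uaddC uadd0 uaddN.

Lemma umulA : associative umul.
Proof.
move=> x y z; rewrite -(ulim_rep x) -(ulim_rep y) -(ulim_rep z) !umulE.
by apply: eq_ulim => i; rewrite mulrA.
Qed.

Lemma umulC : commutative umul.
Proof. by move=> x y; apply: eq_ulim => i; rewrite mulrC. Qed.

Lemma umul1 : left_id (ulim (fun=> 1)) umul.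
Proof.
by move=> x; rewrite -(ulim_rep x) umulE; apply: eq_ulim => i; rewrite mul1r.
Qed.

Lemma umulDl : left_distributive umul uadd.
Proof.
move=> x y z; rewrite -(ulim_rep x) -(ulim_rep y) -(ulim_rep z).
by rewrite !(uaddE, umulE); apply: eq_ulim => i; rewrite mulrDl.
Qed.

HB.instance Definition _ :=
  GRing.Zmodule_isComPzRing.Build ultraproduct umulA umulC umul1 umulDl.

End Ultraproduct.

Arguments ultraproduct {I} U {FU} R.
Arguments ulim {I} U {FU R} x.

Definition prime_number := {p : nat | prime p}.

Definition Fbar (p : prime_number) : closedFieldType :=
  projT1 (countable_algebraic_closure 'F_(sval p)).

Section AffineAlgebras.
Variable k : fieldType.

Definition is_quotient_by (R S : comAlgType k) (J : set R)
    (h : {lrmorphism R -> S}) : Prop :=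
  (forall y, exists x, h x = y) /\ (forall x, h x = 0 <-> J x).

Definition is_localization_at (R S : comAlgType k) (q : set R)
    (h : {lrmorphism R -> S}) : Prop :=
  [/\ forall s, ~ q s -> exists t, h s * t = 1,
      forall y, exists a s, ~ q s /\ y * h s = h a
    & forall a, h a = 0 <-> exists2 s, ~ q s & s * a = 0].

(* A is isomorphic, as a k-algebra, to k[X]/(f). *)
Definition affine_quotient n m (f : 'I_m -> polyring k n) (A : comAlgType k) :=
  exists h : {lrmorphism polyring k n -> A}, is_quotient_by (ideal_gen f) h.

(* A is isomorphic, as a k-algebra, to the localization of k[X]/(f) at the
   ideal generated by the classes of the g j, which is moreover prime. *)
Definition affine_localization n m (f : 'I_m -> polyring k n)
    l (g : 'I_l -> polyring k n) (A : comAlgType k) :=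
  exists (R : comAlgType k) (h : {lrmorphism polyring k n -> R})
         (loc : {lrmorphism R -> A}),
    let q := ideal_gen (fun j => h (g j)) in
    [/\ is_quotient_by (ideal_gen f) h, is_prime_ideal q
      & is_localization_at q loc].

Definition finitely_generated (A : comAlgType k) : Prop :=
  exists n (h : {lrmorphism polyring k n -> A}), forall y, exists x, h x = y.

Definition affine_algebra (A : comAlgType k) : Prop :=
  finitely_generated A \/
  exists (R : comAlgType k) (q : set R) (loc : {lrmorphism R -> A}),
    [/\ finitely_generated R, is_prime_ideal q & is_localization_at q loc].

End AffineAlgebras.

Section Approximations.
Context (U : set_system prime_number) {FU : UltraFilter U}.
Variables (C : fieldType) (theta : C -> ultraproduct U Fbar).

Definition approx_scalar (c : C) (cp : forall p, Fbar p) : Prop :=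
  ulim U cp = theta c.

(* The support condition says that only the coefficients occurring in f are
   approximated; without it the degree of fp p could be unbounded in p. *)
Definition approx_poly n (f : polyring C n) (fp : forall p, polyring (Fbar p) n) :=
  (forall m p, m \notin mpoly.msupp f -> mpoly.mcoeff m (fp p) = 0) /\
  (forall m, approx_scalar (mpoly.mcoeff m f) (fun p => mpoly.mcoeff m (fp p))).

(* Ap is an approximation of A, for some presentation of A as a quotient of a
   polynomial ring, or as a localization of such a quotient.  The A_p are
   prescribed up to isomorphism and for almost all p only. *)
Inductive approximation (A : comAlgType C)
    (Ap : forall p, comAlgType (Fbar p)) : Prop :=
| ApproxQuotient n m (f : 'I_m -> polyring C n)
    (fp : forall p, 'I_m -> polyring (Fbar p) n) of
    (forall i, approx_poly (f i) (fun p => fp p i)) &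
    affine_quotient f A &
    U [set p | affine_quotient (fp p) (Ap p)]
| ApproxLocalization n m (f : 'I_m -> polyring C n)
    (fp : forall p, 'I_m -> polyring (Fbar p) n)
    l (g : 'I_l -> polyring C n)
    (gp : forall p, 'I_l -> polyring (Fbar p) n) of
    (forall i, approx_poly (f i) (fun p => fp p i)) &
    (forall j, approx_poly (g j) (fun p => gp p j)) &
    affine_localization f g A &
    U [set p | affine_localization (fp p) (gp p) (Ap p)].

End Approximations.

(* B is (isomorphic to) D^+.  When D is a domain, E is a copy of D carrying the
   structure needed to form its fraction field, Omega is an algebraic closure of
   that field, and B is identified by j with the integral closure of D in
   Omega.  When D is not a domain, D^+ = 0. *)
Definition is_plus_closure (D : comNzRingType) (B : comPzRingType) : Prop :=
  (GRing.integral_domain_axiom D ->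
   exists (E : idomainType) (e : {rmorphism D -> E}) (Omega : closedFieldType)
          (iota : {rmorphism {fraction E} -> Omega})
          (j : {rmorphism B -> Omega}),
     [/\ bijective e, forall z, algebraicOver iota z, injective j
       & forall z, (exists b, j b = z) <->
                   integralOver (iota \o @FracField.tofrac E) z]) /\
  (~ GRing.integral_domain_axiom D -> forall b : B, b = 0).

(* Main.v *)
Require Import Defs.
From mathcomp Require Import ssreflect ssrfun ssrbool ssrnat ssralg.
From mathcomp Require Import classical_sets filter reals.
From mathcomp Require Import complex.
From mathcomp Require Import eqtype seq fintype bigop poly mxpoly fraction.
From mathcomp Require Import boolp ring.

Import GRing.Theory.

Local Open Scope classical_set_scope.
Local Open Scope ring_scope.

(** Since every monic polynomial over a domain [D^+] has a root there, [B(A)]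
    inherits two first-order properties (trivially when
    the [D^+] are zero): it has no zero divisors, and every
    equation [z (z + b) = c] is solvable in it.  The second one suffices for the
    sum of two ideals (Artin's trick): if [x y = g + h] with [g] in [G] and [h]
    in [H], choose [z] with [z (z + y - x) = g]; then [(x - z) (y + z) = h], and
    the primary property applied to these two factorizations places [x] in
    [G + H] or [y] in [P + Q].  Arbitrary sums are directed unions of finite
    ones, and the empty sum is primary because the zero ideal is prime. *)

Definition quadratically_closed (B : comPzRingType) : Prop :=
  forall b c : B, exists z, z * (z + b) = c.

Definition no_zero_divisors (B : comPzRingType) : Prop :=
  forall x y : B, x * y = 0 -> x = 0 \/ y = 0.

(** * Sums of two ideals and Artin's trick *)

Section BinarySum.
Context {B : comPzRingType}.
Implicit Types P Q G H : set B.

Definition ideal_add G H : set B :=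
  [set x | exists g h, [/\ G g, H h & x = g + h]].

Lemma ideal_opp G x : is_ideal G -> G x -> G (- x).
Proof. by case=> _ _ GM Gx; rewrite -mulN1r; apply: GM. Qed.

Lemma ideal_mulr {G x} a : is_ideal G -> G x -> G (x * a).
Proof. by case=> _ _ GM Gx; rewrite mulrC; apply: GM. Qed.

Lemma ideal_setT G : is_ideal G -> G 1 -> G = setT.
Proof.
by move=> [_ _ GM] G1; apply/seteqP; split=> // x _; rewrite -[x]mulr1; apply: GM.
Qed.

Lemma ideal_add_ideal G H : is_ideal G -> is_ideal H -> is_ideal (ideal_add G H).
Proof.
move=> [G0 GD GM] [H0 HD HM]; split.
- by exists 0, 0; rewrite addr0.
- move=> x y [g [h [Gg Hh ->]]] [g' [h' [Gg' Hh' ->]]].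
  by exists (g + g'), (h + h'); split; [exact: GD|exact: HD|rewrite addrACA].
- move=> a x [g [h [Gg Hh ->]]].
  by exists (a * g), (a * h); split; [exact: GM|exact: HM|rewrite mulrDr].
Qed.

Lemma ideal_addS {P Q G H} : (forall x, G x -> P x) -> (forall x, H x -> Q x) ->
  forall x, ideal_add G H x -> ideal_add P Q x.
Proof. by move=> GP HQ x [g [h [/GP Pg /HQ Qh ->]]]; exists g, h. Qed.

Lemma primary_to_sub {P G} : is_primary_to P G -> forall x, G x -> P x.
Proof. by move=> [_ <-] x Gx; exists 1%N. Qed.

Lemma primary_to_mul {P G} : is_primary_to P G ->
  forall x y, G (x * y) -> G x \/ P y.
Proof. by move=> [[_ _ Gp] <-]. Qed.

Lemma primary_to_pow {P G} : is_primary_to P G ->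
  forall x, P x -> exists n, G (x ^+ n).
Proof. by move=> [_ <-]. Qed.

Lemma prime_primary_to P : is_prime_ideal P -> is_primary_to P P.
Proof.
move=> [Pi P1 Pp]; have rad x n : P (x ^+ n) -> P x.
  by elim: n => [|n IHn]; rewrite ?expr0 // exprS => /Pp[].
split; first split=> //.
  by move=> x y /Pp[]; [left|right; exists 1%N].
by apply/seteqP; split=> [x [n /rad]|x Px] //; exists 1%N.
Qed.

(** This lets the primality of a sum of primes be read off from the primary statement. *)
Lemma primary_to_self_prime P : is_primary_to P P -> is_prime_ideal P.
Proof. by move=> PP; case: (PP) => [[? ? _] _]; split=> //; apply: primary_to_mul. Qed.

Lemma exprD_mulr (x y : B) n : exists c, (x + y) ^+ n = x ^+ n + y * c.
Proof.
elim: n => [|n [c IHn]]; first by exists 0; rewrite !expr0 mulr0 addr0.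
by exists (x * c + x ^+ n + y * c); rewrite !exprS IHn; ring.
Qed.

Lemma ideal_add_pow {P Q G H} : is_ideal G -> is_ideal H ->
    (forall x, P x -> exists n, G (x ^+ n)) ->
    (forall x, Q x -> exists n, H (x ^+ n)) ->
  forall x, ideal_add P Q x -> exists n, ideal_add G H (x ^+ n).
Proof.
move=> Gi Hi PG QH _ [p [q [/PG[n Gp] /QH[m Hq] ->]]].
(* Expanding twice gives [(p + q) ^+ n = p ^+ n + q * c], whose [m]-th power is
   [(q * c) ^+ m + p ^+ n * d]; here [p ^+ n] is in [G] and [q ^+ m] in [H]. *)
have [c Ec] := exprD_mulr p q n; have [d Ed] := exprD_mulr (q * c) (p ^+ n) m.
exists (n * m)%N; exists (p ^+ n * d), (q ^+ m * c ^+ m).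
split; [exact: ideal_mulr|exact: ideal_mulr|].
by rewrite exprM Ec addrC Ed exprMn addrC.
Qed.

Lemma ideal_add_mul P Q G H : quadratically_closed B ->
    is_ideal P -> is_ideal Q -> is_primary_to P G -> is_primary_to Q H ->
  forall x y, ideal_add G H (x * y) -> ideal_add G H x \/ ideal_add P Q y.
Proof.
move=> qB Pi Qi PG QH x y [g [h [Gg Hh Exy]]].
have [z Ez] := qB (y - x) g.
have Eh : (x - z) * (y + z) = h.
  have -> : (x - z) * (y + z) = x * y - z * (z + (y - x)) by ring.
  by rewrite Exy Ez addrC addKr.
have mulG := primary_to_mul PG; have mulH := primary_to_mul QH.
have GP := primary_to_sub PG; have HQ := primary_to_sub QH.
rewrite -Ez in Gg; rewrite -Eh in Hh.
(* With [w = z + (y - x)], the four factors satisfy [y = - z + (y + z) = w + (x - z)] and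
   [x = z + (x - z) = - w + (y + z)]. Every outcome of the case analysis matches one of these. *)
have PQ1 : P z -> Q (y + z) -> ideal_add P Q y.
  move=> Pz Qyz; exists (- z), (y + z).
  by split=> //; [exact: ideal_opp|ring].
have PQ2 : P (z + (y - x)) -> Q (x - z) -> ideal_add P Q y.
  by move=> Pw Qw; exists (z + (y - x)), (x - z); split=> //; ring.
have [Gz|Pw] := mulG _ _ Gg.
  have [Hxz|/(PQ1 (GP _ Gz))] := mulH _ _ Hh; last by right.
  by left; exists z, (x - z); split=> //; ring.
(* The primary property is asymmetric in the two factors; commuting the product makes the other
   factor the candidate for [H], and then for [G]. *)
rewrite mulrC in Hh; have [Hyz|/(PQ2 Pw)] := mulH _ _ Hh; last by right.
rewrite mulrC in Gg; have [Gw|Pz] := mulG _ _ Gg; last first.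
  by right; apply: PQ1 => //; exact: HQ.
left; exists (- (z + (y - x))), (y + z).
by split=> //; [apply: ideal_opp Gw; case: PG => [[]]|ring].
Qed.

Lemma ideal_add_primary_to P Q G H : quadratically_closed B ->
    is_ideal P -> is_ideal Q -> is_primary_to P G -> is_primary_to Q H ->
    ~ ideal_add P Q 1 ->
  is_primary_to (ideal_add P Q) (ideal_add G H).
Proof.
move=> qB Pi Qi PG QH PQ1; have GHmul := ideal_add_mul _ _ _ _ qB Pi Qi PG QH.
have [Gi Hi] : is_ideal G /\ is_ideal H by case: PG QH => [[? _ _] _] [[? _ _] _].
have GHPQ := ideal_addS (primary_to_sub PG) (primary_to_sub QH).
have powGH := ideal_add_pow Gi Hi (primary_to_pow PG) (primary_to_pow QH).
split; first split.
- exact: ideal_add_ideal.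
- by move=> /GHPQ.
- by move=> x y /GHmul[|/powGH]; [left|right].
apply/seteqP; split=> [x [n]|x /powGH] //.
(* Peel off one factor [x] at a time: either it lies in [P + Q], or the smaller power stays in
   [G + H]. The power [0] would put [1] in [P + Q]. *)
elim: n => [|n IHn]; first by rewrite expr0 => /GHPQ.
by rewrite exprSr => /GHmul[].
Qed.

End BinarySum.

(** * Arbitrary sums as directed unions of finite ones *)

Section Sums.
Context {B : comPzRingType} {I : Type}.
Implicit Types (J P G : I -> set B) (s : seq I).

(** Lists, with repetitions allowed, need no decidable equality on [I], and concatenation makes the
    finite sums directed. *)
Definition seq_sum J s : set B :=
  foldr (fun i K => ideal_add (J i) K) [set 0] s.

Lemma seq_sum_ideal J s : (forall i, is_ideal (J i)) -> is_ideal (seq_sum J s).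
Proof.
move=> Ji; elim: s => [|i s IHs]; last exact: ideal_add_ideal.
by split=> //= [x y -> ->|a x ->]; rewrite ?addr0 ?mulr0.
Qed.

Lemma seq_sum_cat J s t x y :
  seq_sum J s x -> seq_sum J t y -> seq_sum J (s ++ t) (x + y).
Proof.
elim: s x => [|i s IHs] x /=; first by move=> ->; rewrite add0r.
move=> [g [h [Jg Jh ->]]] Jy; exists g, (h + y).
by split=> //; [exact: IHs|rewrite addrA].
Qed.

Lemma ideal_sum_seq J x : ideal_sum J x <-> exists s, seq_sum J s x.
Proof.
split=> [[n [k [y [Jy ->]]]]|[s]].
  elim: n k y Jy => [|n IHn] k y Jy; first by exists [::]; rewrite big_ord0.
  have [j|s Js] := IHn (k \o lift ord0) (y \o lift ord0); first exact: Jy.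
  by exists (k ord0 :: s), (y ord0); eexists; split; last by rewrite big_ord_recl.
elim: s x => [|i s IHs] x /=.
  (* [I] may be empty, so the index map on ['I_0] comes from the absurd bound [lt0]. *)
  by move=> ->; exists 0%N, (fun j : 'I_0 => match j with Ordinal _ lt0 =>
       False_rect I (notF lt0) end), (fun=> 0); rewrite big_ord0; split=> // -[].
move=> [g [_ [Jg /IHs[n [k [y [Jy ->]]]] ->]]].
exists n.+1, (fun j => oapp k i (unlift ord0 j)),
  (fun j => oapp y g (unlift ord0 j)); split.
  by move=> j; case: unliftP => [j' _|_] /=.
rewrite big_ord_recl unlift_none; congr (_ + _).
by apply: eq_bigr => j _; rewrite liftK.
Qed.

Lemma ideal_sum_ideal J : (forall i, is_ideal (J i)) -> is_ideal (ideal_sum J).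
Proof.
move=> Ji; split.
- by apply/ideal_sum_seq; exists [::].
- move=> x y /ideal_sum_seq[s Js] /ideal_sum_seq[t Jt].
  by apply/ideal_sum_seq; exists (s ++ t); apply: seq_sum_cat.
- move=> a x /ideal_sum_seq[s Js]; apply/ideal_sum_seq; exists s.
  by have [_ _] := seq_sum_ideal J s Ji; apply.
Qed.

Section PrimarySum.
Hypotheses (qB : quadratically_closed B) (dB : no_zero_divisors B).
Context {P G : I -> set B}.
Hypotheses (Pprime : forall i, is_prime_ideal (P i)).
Hypotheses (PG : forall i, is_primary_to (P i) (G i)).

Let Pideal i : is_ideal (P i). Proof. by case: (Pprime i). Qed.

Lemma zero_prime_ideal : (1 : B) <> 0 -> is_prime_ideal [set (0 : B)].
Proof.
by move=> B1; split=> //; split=> //= [x y -> ->|a x ->]; rewrite ?addr0 ?mulr0.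
Qed.

Lemma seq_sum_primary_to s :
  ~ seq_sum P s 1 -> is_primary_to (seq_sum P s) (seq_sum G s).
Proof.
elim: s => [|i s IHs] Ps1; first exact/prime_primary_to/zero_prime_ideal.
apply: ideal_add_primary_to => //; first exact: seq_sum_ideal.
(* The tail sum is contained in the whole one, so it is proper too. *)
apply: IHs => Ps; apply: Ps1; exists 0, 1; rewrite add0r.
by split=> //; case: (Pideal i).
Qed.

(** Each condition starts from a single element of a sum, which already lies in some finite sum over
    a list [s]; the finite case for that [s] then applies. *)
Lemma ideal_sum_primary_to :
  ideal_sum P <> setT -> is_primary_to (ideal_sum P) (ideal_sum G).
Proof.
move=> PT; have P1 s : ~ seq_sum P s 1.
  move=> Ps1; apply: PT; apply: ideal_setT; first exact: ideal_sum_ideal.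
  by apply/ideal_sum_seq; exists s.
have sumPG s := seq_sum_primary_to s (P1 s).
split; first split.
- by apply: ideal_sum_ideal => i; case: (PG i) => -[].
- by move=> /ideal_sum_seq[s /(primary_to_sub (sumPG s))]; apply: P1.
- move=> x y /ideal_sum_seq[s]; have [[_ _ +] _] := sumPG s.
  move=> /[apply] -[Gx|[n Gy]]; [left|right; exists n]; apply/ideal_sum_seq;
    by exists s.
apply/seteqP; split=> x.
  move=> [n /ideal_sum_seq[s Gs]]; apply/ideal_sum_seq; exists s.
  by have [_ <-] := sumPG s; exists n.
move=> /ideal_sum_seq[s /(primary_to_pow (sumPG s))[n Gs]].
by exists n; apply/ideal_sum_seq; exists s.
Qed.

End PrimarySum.
End Sums.

(** * The two first-order properties of [D^+] *)

Lemma integral_quadratic_root (S : comNzRingType) (K : fieldType)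
    (f : {rmorphism S -> K}) (b c z : K) :
    integralOver f b -> integralOver f c -> z * (z + b) = c ->
  integralOver f z.
Proof.
move=> fb fc Ez; pose p := 'X * ('X + b%:P) - c%:P.
have Ep : p = 'X^2 + (b *: 'X - c%:P) by rewrite /p mulrDr -mul_polyC; ring.
have sp : (size (b *: 'X - c%:P : {poly K})%R < size ('X^2 : {poly K}))%N.
  rewrite size_polyXn ltnS (leq_trans (size_polyD _ _)) // geq_max size_polyN.
  rewrite (leq_trans (size_scale_leq _ _)) ?size_polyX //.
  by rewrite (leq_trans (size_polyC_leq1 _)).
apply: (@integral_root_monic _ _ f _ p).
- by rewrite Ep monicE lead_coefDl // lead_coefXn.
- by rewrite /root /p !hornerE Ez subrr.
(* The coefficients are [- c], [b], [1], and [0] from degree three on. *)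
move=> _ /(nthP 0)[i _ <-]; rewrite Ep !coefE.
case: i => [|[|[|i]]] /=; rewrite ?mulr0 ?mulr1 ?subr0 ?sub0r ?add0r ?addr0.
- exact: integral_opp.
- by [].
- exact: integral1.
- exact: integral0.
Qed.

Lemma plus_closure_quadratic (D : comNzRingType) (B : comPzRingType) :
  is_plus_closure D B -> quadratically_closed B.
Proof.
move=> [domB zeroB] b c; case: (pselect (GRing.integral_domain_axiom D)); last first.
  by move/zeroB=> B0; exists 0; rewrite (B0 c) mul0r.
move/domB => [E [e [Omega [iota [j [_ _ injj jint]]]]]].
(* The equation solved is [z ^+ 2 = j c - j b * z]. *)
have [z Ez] := @solve_monicpoly Omega 2 (nth 0 [:: j c; - j b]) isT.
have {}Ez : z * (z + j b) = j c.
  move: Ez; rewrite 2!big_ord_recl big_ord0 /= expr0 expr1 mulr1 addr0 => Ez.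
  by rewrite mulrDr -expr2 Ez; ring.
have [a Ea] : exists a, j a = z.
  by apply/jint; apply: integral_quadratic_root Ez; apply/jint;
    [exists b|exists c].
by exists a; apply: injj; rewrite rmorphM rmorphD Ea.
Qed.

Lemma plus_closure_no_zero_divisors (D : comNzRingType) (B : comPzRingType) :
  is_plus_closure D B -> no_zero_divisors B.
Proof.
move=> [domB zeroB] x y xy0.
case: (pselect (GRing.integral_domain_axiom D)); last by move/zeroB; left.
move/domB => [E [e [Omega [iota [j [_ _ injj _]]]]]].
have /eqP : j x * j y = 0 by rewrite -rmorphM xy0 rmorph0.
by rewrite mulf_eq0 => /orP[]/eqP j0; [left|right]; apply: injj; rewrite j0 rmorph0.
Qed.

(** * Transfer to the ultraproduct *)

Section UltraproductTransfer.
Context {I : Type} {U : set_system I} {FU : UltraFilter U}.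
Variable B : I -> comPzRingType.

Lemma ultraproduct_quadratic :
    U [set i | quadratically_closed (B i)] ->
  quadratically_closed (ultraproduct U B).
Proof.
move=> UB b c; have [b' <-] := ulim_surj b; have [c' <-] := ulim_surj c.
(* The implication makes the choice of roots total; [0] is a default at indices where [B i] is not
   quadratically closed. *)
have z i : {z : B i | quadratically_closed (B i) -> z * (z + b' i) = c' i}.
  apply: cid; have [qB|nqB] := pselect (quadratically_closed (B i)); last by exists 0.
  by have [z Ez] := qB (b' i) (c' i); exists z.
exists (ulim U (fun i => sval (z i))); rewrite [_ + _]uaddE [_ * _]umulE; apply/ulimP.
by apply: filterS UB => i; exact: svalP (z i).
Qed.

Lemma ultraproduct_no_zero_divisors :
    U [set i | no_zero_divisors (B i)] ->
  no_zero_divisors (ultraproduct U B).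
Proof.
move=> UB x y; have [x' <-] := ulim_surj x; have [y' <-] := ulim_surj y.
rewrite [_ * _]umulE => /ulimP xy0.
(* The ultrafilter decides whether [x'] vanishes almost everywhere; if not, [y'] must. *)
have [x0|nx0] := in_ultra_setVsetC [set i | x' i = 0] FU; first by left; apply/ulimP.
right; apply/ulimP; apply: filterS3 UB xy0 nx0 => i dB /dB[] //.
Qed.

End UltraproductTransfer.

Theorem corollary3p3
  (R : realType)
  (U : set_system prime_number) (FU : UltraFilter U)
  (U_nonprincipal : forall p : prime_number, ~ U [set p])
  (theta : {rmorphism R[i] -> ultraproduct U Fbar})
  (theta_bij : bijective theta)
  (A : comAlgType R[i])
  (A_affine : affine_algebra A)
  (A_domain : GRing.integral_domain_axiom A)
  (Ap : forall p : prime_number, comAlgType (Fbar p))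
  (Ap_approx : approximation theta A Ap)
  (Bp : prime_number -> comPzRingType)
  (Bp_plus : U [set p | is_plus_closure (Ap p) (Bp p)]) :
  let BA : comPzRingType := ultraproduct U Bp in
  (forall (I : Type) (P : I -> set BA),
     (forall i, is_prime_ideal (P i)) ->
     is_prime_ideal (ideal_sum P) \/ ideal_sum P = setT) /\
  (forall (I : Type) (P G : I -> set BA),
     (forall i, is_prime_ideal (P i)) ->
     (forall i, is_primary_to (P i) (G i)) ->
     ideal_sum P <> setT ->
     is_primary_to (ideal_sum P) (ideal_sum G)).
Proof.
move=> BA.
have qB : quadratically_closed BA.
  by apply: ultraproduct_quadratic; apply: filterS Bp_plus => p /plus_closure_quadratic.
have dB : no_zero_divisors BA.
  apply: ultraproduct_no_zero_divisors.
  by apply: filterS Bp_plus => p /plus_closure_no_zero_divisors.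
split=> [I P Pprime|I P G Pprime PG]; last exact: ideal_sum_primary_to.
have [|PT] := pselect (ideal_sum P = setT); [by right|left].
(* Primality is the primary statement with [G] taken to be [P]. *)
apply: primary_to_self_prime; apply: ideal_sum_primary_to => // i.
exact: prime_primary_to.
Qed.
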